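(* Let $\mathcal{H} = (Q, I, O, q_0, \delta, \lambda)$ be a Mealy machine, let $k \in \mathbb{N}$, let $P \subseteq I^*$ be a minimal state cover for $\mathcal{H}$ and let $W \subseteq I^*$ be a characterization set for $\mathcal{H}$. Let $g$ be a function assigning to $\mathcal{H}$ a set $g(\mathcal{H})$ of subsets of $Q$, and for $X \subseteq Q$ let $I_X = \{ i \in I \mid \exists q, q' \in X.\ \delta(q,i) = q' \}$. Consider the test suite \[ T = \mathsf{ETS}_{E^g_{\mathsf{C}},k}(\mathcal{H}) = \bigcup_{v \in P} \Big( v \cdot \big(\textstyle\bigcup_{X \in g(\mathcal{H})} I_X^{\leq k-1}\big) \cdot I^{\leq 2} \cdot W \Big). \] Let $\mathcal{C}$ be the set of all Mealy machines $\mathcal{S}$ with input set $I$ such that $|\mathcal{S}| - |\mathcal{H}| \leq k$ and \[ Q^{\mathcal{S}} \setminus Q^{\mathcal{S}}_{sink} \subseteq \bigcup_{X \in g(\mathcal{H})} \Delta^{\mathcal{S}}\big(P \cdot I_X^{\leq k}\big). \] Then $T$ is complete for $\mathcal{H}$ with respect to $\mathcal{C}$: for every $\mathcal{S} \in \mathcal{C}$, if $\mathcal{H} \sim_T \mathcal{S}$ then $\mathcal{H} \sim \mathcal{S}$.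
   Context: A Mealy machine is a tuple $\mathcal{M} = (Q, I, O, q_0, \delta, \lambda)$ with finite sets $Q, I, O$ of states, inputs and outputs, initial state $q_0 \in Q$, transition function $\delta: Q \times I \to Q$ and output function $\lambda: Q \times I \to O$. $\delta$ and $\lambda$ are extended to words in the standard way ($\delta(q,\varepsilon)=q$, $\delta(q,wi)=\delta(\delta(q,w),i)$, and $\lambda(q,w)$ is the sequence of outputs produced along $w$); $\delta(w)$ abbreviates $\delta(q_0,w)$. Superscripts (e.g. $Q^{\mathcal{M}}, \delta^{\mathcal{M}}$) indicate the machine. $|\mathcal{M}|$ is the number of states. For $Q' \subseteq Q$ and $L \subseteq I^*$, $\Delta^{\mathcal{M}}(Q', L) = \{\delta(q,w) \mid q \in Q', w \in L\}$ and $\Delta^{\mathcal{M}}(L) = \Delta^{\mathcal{M}}(\{q_0\}, L)$. A state $q$ is a sink if $\delta(q,i)=q$ for all $i \in I$; $Q_{sink}$ denotes the set of sinks. For sets of words, $\cdot$ is concatenation, and $J^{\leq n}$ is the set of words over $J$ of length at most $n$. For $L \subseteq I^*$ and machines $\mathcal{H},\mathcal{S}$ with input set $I$, states $p \in Q^{\mathcal{H}}$, $q \in Q^{\mathcal{S}}$ are $L$-equivalent ($p \sim_L q$) if $\lambda^{\mathcal{H}}(p,w) = \lambda^{\mathcal{S}}(q,w)$ for all $w \in L$; they are equivalent ($p \sim q$) if $I^*$-equivalent; $\mathcal{H} \sim_L \mathcal{S}$ (resp. $\mathcal{H} \sim \mathcal{S}$) means $q_0^{\mathcal{H}} \sim_L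 q_0^{\mathcal{S}}$ (resp. $\sim$). A test suite $T \subseteq I^*$ is complete for $\mathcal{H}$ w.r.t. a set $\mathcal{C}$ of Mealy machines if for all $\mathcal{S} \in \mathcal{C}$, $\mathcal{H} \sim_T \mathcal{S}$ implies $\mathcal{H} \sim \mathcal{S}$. A state cover for $\mathcal{H}$ is $P \subseteq I^*$ with $\varepsilon \in P$ and $\Delta^{\mathcal{H}}(P) = \Delta^{\mathcal{H}}(I^* )$; minimal means of minimal size. A characterization set for $\mathcal{H}$ is a non-empty $W \subseteq I^*$ such that for all $p,q \in Q^{\mathcal{H}}$, $p \sim_W q$ implies $p \sim q$.
   Formalization: The machine H is additionally assumed minimal (all states reachable and pairwise inequivalent) and g(H) is assumed nonempty, since the claim fails without these; for k = 0 the exponent k-1 is read as 0. *)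

(* Defs.v *)
From mathcomp Require Import all_boot finmap.
From mathcomp Require Import mathcomp_extra boolp classical_sets functions cardinality.

Set Implicit Arguments.
Unset Strict Implicit.
Unset Printing Implicit Defensive.

Local Open Scope classical_set_scope.

(* Every machine has its own finite output set, drawn from an ambient type U,
   so that outputs of machines with different output sets can be compared. *)
Record mealy (I : finType) (U : choiceType) := Mealy {
  state : finType;
  outputs : {fset U};
  init : state;
  delta : state -> I -> state;
  lambda : state -> I -> outputs
}.

Section Words.
Variable I : finType.

Definition lang_cat (A B : set (seq I)) : set (seq I) :=
  [set u ++ v | u in A & v in B].

Definition words_upto (J : {set I}) (n : nat) : set (seq I) :=
  [set w | all [in J] w /\ size w <= n].

End Words.

Notation "A *w B" := (lang_cat A B) (at level 40, left associativity).

Section Machines.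
Variables (I : finType) (U : choiceType).
Implicit Types (M H S : mealy I U) (L P W T : set (seq I)).

Definition deltaw M (q : state M) (w : seq I) : state M :=
  foldl (@delta I U M) q w.

Fixpoint lambdaw M (q : state M) (w : seq I) : seq U :=
  if w is i :: w' then val (lambda q i) :: lambdaw (delta q i) w' else [::].

Definition Delta_from M (A : set (state M)) L : set (state M) :=
  [set deltaw q w | q in A & w in L].

Definition Delta M L : set (state M) := Delta_from [set init M] L.
Arguments Delta : clear implicits.

Definition sinks M : set (state M) := [set q | forall i, delta q i = q].
Arguments sinks : clear implicits.

Definition state_equiv_on L H S (p : state H) (q : state S) : Prop :=
  forall w, L w -> lambdaw p w = lambdaw q w.

Definition state_equiv H S (p : state H) (q : state S) : Prop :=
  state_equiv_on setT p q.

Definition equiv_on L H S : Prop := state_equiv_on L (init H) (init S).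

Definition equiv H S : Prop := state_equiv (init H) (init S).

(* [set (mealy I U)] would be a universe inconsistency, since a machine contains
   a finType; classes of machines are therefore plain predicates. *)
Definition complete H T (C : mealy I U -> Prop) : Prop :=
  forall S, C S -> equiv_on T H S -> equiv H S.

Definition minimal_machine M : Prop :=
  (forall q : state M, exists w, deltaw (init M) w = q) /\
  (forall p q : state M, state_equiv p q -> p = q).

Definition state_cover H P : Prop := P [::] /\ Delta H P = Delta H setT.

Definition minimal_state_cover H P : Prop :=
  state_cover H P /\ forall P', state_cover H P' -> (P #<= P')%card.

Definition characterization_set H W : Prop :=
  W !=set0 /\ forall p q : state H, state_equiv_on W p q -> state_equiv p q.

Definition internal_inputs M (X : {set state M}) : {set I} :=
  [set i | [exists q in X, exists q' in X, delta q i == q']]%SET.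

(* [k - 1] is truncated: for k = 0 the middle factor only contains the empty
   word (provided g H is nonempty). *)
Definition ets (g : forall M, {set {set state M}}) (k : nat) P W H :
    set (seq I) :=
  \bigcup_(v in P)
    ([set v] *w
     (\bigcup_(X in [set` g H]) words_upto (internal_inputs X) (k - 1)) *w
     words_upto [set: I]%SET 2 *w
     W).

(* Truncation is harmless in the bound on the number of extra states. *)
Definition fault_domain (g : forall M, {set {set state M}}) (k : nat) P H
    (S : mealy I U) : Prop :=
  #|state S| - #|state H| <= k /\
  ~` sinks S `<=`
    \bigcup_(X in [set` g H]) Delta S (P *w words_upto (internal_inputs X) k).

End Machines.

Arguments Delta {I U} M L.
Arguments sinks {I U} M.

(* Main.v *)
Require Import Defs.
From mathcomp Require Import all_boot finmap.
From mathcomp Require Import mathcomp_extra boolp classical_sets functions cardinality.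

(** Call a word tested if the suite contains all its extensions by [W].  Every
    word of [P . I_X^{<=k}], and every one-letter extension of it, is tested, so
    each state of [S] reached by such a word is [W]-equivalent to exactly one
    state of [H].  As all non-sinks are reached in this way, the pairs of states
    reached by these words form a bisimulation, except where a step leads to an
    unreached sink [t].  In that case the layers [Delta S (P . I_X^{<=j})], of
    which the first has at least [|H|] elements, cannot strictly grow up to
    [j = k] without exhausting the at most [|H| + k] states, so they are already
    stationary at [j = k - 1]: the source of the step is reached by a word of
    [P . I_X^{<=k-1}], whose two-letter extensions are all tested, and this
    forces the state of [H] matching [t] to be a sink with the same outputs. *)

Set Implicit Arguments.
Unset Strict Implicit.
Unset Printing Implicit Defensive.

(** If each of the [n.+1] applications added an element, the result would have at least
    [#|A| + n.+1] elements. So some application adds none, and from there on the iteration is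
    constant. *)
Lemma iter_inflationary_stationary (T : finType) (f : {set T} -> {set T})
    (A : {set T}) (n : nat) :
  (forall B : {set T}, B \subset f B) ->
  #|iter n.+1 f A| < #|A| + n.+1 -> iter n.+1 f A = iter n f A.
Proof.
move=> f_infl; elim: n => [|n IHn] lt_card.
  apply/eqP; rewrite eq_sym eqEcard f_infl /=.
  by move: lt_card; rewrite addn1 ltnS.
have [lt_n|le_n] := ltnP #|iter n.+1 f A| (#|A| + n.+1).
  by rewrite [LHS]iterS {1}(IHn lt_n).
apply/eqP; rewrite eq_sym eqEcard {1}[iter n.+2 f A]iterS f_infl /=.
by apply: leq_trans le_n; rewrite -ltnS -addnS.
Qed.

Section Runs.
Variables (I : finType) (U : choiceType).
Implicit Types (M H S : mealy I U).

Lemma deltaw_cat M (q : state M) u v :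
  deltaw q (u ++ v) = deltaw (deltaw q u) v.
Proof. exact: foldl_cat. Qed.

Lemma size_lambdaw M (q : state M) w : size (lambdaw q w) = size w.
Proof. by elim: w q => //= i w IHw q; rewrite IHw. Qed.

Lemma lambdaw_cat M (q : state M) u v :
  lambdaw q (u ++ v) = lambdaw q u ++ lambdaw (deltaw q u) v.
Proof. by elim: u q => //= i u IHu q; rewrite IHu. Qed.

Lemma eq_lambdaw_cat H S (p : state H) (q : state S) u v :
  lambdaw p (u ++ v) = lambdaw q (u ++ v) ->
  lambdaw p u = lambdaw q u /\
  lambdaw (deltaw p u) v = lambdaw (deltaw q u) v.
Proof.
rewrite !lambdaw_cat => /eqP.
by rewrite eqseq_cat ?size_lambdaw // => /andP[/eqP ? /eqP ?].
Qed.

Lemma bisimulation_equiv H S (R : state H -> state S -> Prop) :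
  (forall p q, R p q -> forall i,
     val (lambda p i) = val (lambda q i) /\ R (delta p i) (delta q i)) ->
  forall p q, R p q -> state_equiv p q.
Proof.
move=> bisimR p q Rpq w _; elim: w p q Rpq => //= i w IHw p q /bisimR/(_ i).
by case=> -> /IHw ->.
Qed.

Definition step M (J : {set I}) (A : {set state M}) : {set state M} :=
  A :|: [set delta q i | q in A, i in J].

Definition reached M (P : set (seq I)) : {set state M} :=
  [set q | `[< exists2 v, P v & deltaw (init M) v = q >]].

Lemma step_sub M (J : {set I}) (A : {set state M}) : A \subset step J A.
Proof. exact: finset.subsetUl. Qed.

Lemma iter_stepP M (J : {set I}) (P : set (seq I)) n (q : state M) :
  q \in iter n (step J) (reached M P) <->
  exists v u, [/\ P v, words_upto J n u & deltaw (init M) (v ++ u) = q].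
Proof.
elim: n q => [|n IHn] q.
  rewrite inE; split=> [/asboolP[v Pv <-]|[v [[|i u] [Pv [_ //] _ <-]]]].
  - by exists v, [::]; rewrite cats0.
  - by apply/asboolP; exists v; rewrite ?cats0.
rewrite iterS inE; split.
  case/orP=> [/IHn[v [u [Pv [Ju le_u] <-]]]|].
    by exists v, u; do !split=> //; exact: leqW.
  case/imset2P=> q' i /IHn[v [u [Pv [Ju le_u] <-]]] Ji ->.
  exists v, (rcons u i); split=> //.
    by split; rewrite ?all_rcons ?size_rcons ?Ji.
  by rewrite -rcons_cat -cats1 deltaw_cat.
case=> v [u [Pv [Ju le_u] <-]]; case/lastP: u Ju le_u => [_ _|u i].
  by apply/orP; left; apply/IHn; exists v, [::].
rewrite all_rcons size_rcons ltnS => /andP[Ji Ju] le_u.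
apply/orP; right; rewrite -rcons_cat -cats1 deltaw_cat.
by apply: imset2_f => //; apply/IHn; exists v, u.
Qed.

End Runs.

Section Suite.
Variables (I : finType) (U : choiceType) (H S : mealy I U) (k : nat).
Variables (P W : set (seq I)) (g : forall M : mealy I U, {set {set state M}}).
Hypotheses (minimalH : minimal_machine H) (charW : characterization_set H W).
Hypothesis agreeT : equiv_on (ets g k P W H) H S.

Definition tested (x : seq I) : Prop :=
  forall w, W w -> lambdaw (init H) (x ++ w) = lambdaw (init S) (x ++ w).

Lemma tested_equiv_on x : tested x ->
  state_equiv_on W (deltaw (init H) x) (deltaw (init S) x).
Proof. by move=> tx w /tx /eq_lambdaw_cat[]. Qed.

(** As [W] is non-empty, some test runs through the letter [i] and exposes its output. *)
Lemma tested_lambda x i : tested (x ++ [:: i]) ->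
  val (lambda (deltaw (init H) x) i) = val (lambda (deltaw (init S) x) i).
Proof.
have [[w Ww] _] := charW.
by move=> /(_ w Ww); rewrite -catA => /eq_lambdaw_cat[_ []].
Qed.

(** Both states of [H] are [W]-equivalent to the same state of [S], hence to each other; [W]
    characterizes and [H] is minimal, so they coincide. *)
Lemma tested_inj x y : tested x -> tested y ->
  deltaw (init S) x = deltaw (init S) y ->
  deltaw (init H) x = deltaw (init H) y.
Proof.
move=> tx ty eq_xy; apply: minimalH.2; apply: charW.2 => w Ww.
by rewrite (tested_equiv_on tx Ww) eq_xy (tested_equiv_on ty Ww).
Qed.

Definition access (n : nat) (x : seq I) : Prop :=
  exists X v u, [/\ X \in g H, P v, words_upto (internal_inputs X) n u
                  & x = v ++ u].

Lemma access_tested2 x a : access (k - 1) x -> size a <= 2 -> tested (x ++ a).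
Proof.
move=> [X [v [u [gX Pv Ju ->]]]] le_a w Ww; apply: agreeT; exists v => //.
exists ((v ++ u) ++ a); last by exists w.
exists (v ++ u).
  by exists v => //; exists u => //; exists X.
by exists a => //; split=> //; apply/allP=> i _; rewrite inE.
Qed.

Lemma access_tested1 x a : access k x -> size a <= 1 -> tested (x ++ a).
Proof.
move=> [X [v [u [gX Pv [Ju le_u] ->]]]] le_a.
(* At most one letter of [u] lies beyond its prefix of length [k - 1], also for [k = 0]; together
   with [a] it fits into the factor of words of length at most 2. *)
rewrite -(cat_take_drop (k - 1) u) catA -catA; apply: access_tested2.
  exists X, v, (take (k - 1) u); split=> //; split; last first.
    by rewrite size_take_min geq_minl.
  by move: Ju; rewrite -{1}(cat_take_drop (k - 1) u) all_cat => /andP[].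
rewrite size_cat size_drop -[2]/(1 + 1) leq_add // leq_subLR.
by rewrite subn1 addn1; apply: leq_trans le_u (leqSpred k).
Qed.

Lemma access_tested x : access k x -> tested x.
Proof. by rewrite -{2}[x]cats0 => /access_tested1; apply. Qed.

Hypotheses (coverP : state_cover H P) (le_card : #|state S| - #|state H| <= k).

(** Choosing in [P] a word for each state of [H] gives a map into the states of [S], injective by
    [tested_inj]. A member of [g H] makes the words of [P] tested. *)
Lemma leq_card_reached : (exists X, X \in g H) -> #|state H| <= #|reached S P|.
Proof.
move=> [X gX].
have accP v : P v -> access k v by exists X, v, [::]; rewrite cats0.
have cover p : exists2 v, P v & deltaw (init H) v = p.
  have [w <-] := minimalH.1 p.
  have : Delta H setT (deltaw (init H) w) by exists (init H) => //; exists w.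
  by rewrite -coverP.2 => -[_ -> [v Pv <-]]; exists v.
have /choice[word wordP] : forall p, exists v, P v /\ deltaw (init H) v = p.
  by move=> p; have [v] := cover p; exists v.
rewrite -cardsT -(card_imset _ (f := fun p => deltaw (init S) (word p))).
  apply/subset_leq_card/fintype.subsetP=> _ /imsetP[p _ ->]; rewrite inE.
  by apply/asboolP; exists (word p) => //; have [] := wordP p.
move=> p p' eq_pp'; rewrite -(wordP p).2 -(wordP p').2.
by apply: tested_inj eq_pp'; apply/access_tested/accP; apply: (wordP _).1.
Qed.

(** Missing [t], the layers have at most [#|state S| - 1] states, too few for [k] strict growth
    steps from at least [#|state H|]. *)
Lemma access_shorter x (t : state S) : access k x ->
  (forall y, access k y -> deltaw (init S) y <> t) ->
  exists2 y, access (k - 1) y & deltaw (init S) y = deltaw (init S) x.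
Proof.
move=> [X [v [u [gX Pv Ju ->]]]] unreached.
(* For [k = 0] truncation gives [k - 1 = k], and the word itself serves. *)
case: k Ju unreached le_card leq_card_reached => [|n] Ju unreached le_n le_H.
  by exists (v ++ u) => //; exists X, v, u.
set A := reached S P; pose f := @step I U S (internal_inputs X).
have sin : deltaw (init S) (v ++ u) \in iter n.+1 f A.
  by apply/iter_stepP; exists v, u.
have tout : t \notin iter n.+1 f A.
  apply/negP=> /iter_stepP[v' [u' [Pv' Ju' eq_t]]].
  by apply: (unreached (v' ++ u')) => //; exists X, v', u'.
move: sin; rewrite iter_inflationary_stationary.
- move=> /iter_stepP[v' [u' [Pv' Ju' eq_s]]].
  by exists (v' ++ u') => //; exists X, v', u'; rewrite subn1.
- exact: step_sub.
have lt_S : #|iter n.+1 f A| < #|state S|.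
  rewrite -cardsT; apply: proper_card; apply/properP; split.
    exact: finset.subsetT.
  by exists t.
apply: leq_trans lt_S _; rewrite leq_subLR in le_n.
by apply: leq_trans le_n _; rewrite leq_add2r le_H //; exists X.
Qed.

End Suite.

Theorem theorem3 (I : finType) (U : choiceType) (H : mealy I U) (k : nat)
    (P W : set (seq I)) (g : forall M : mealy I U, {set {set state M}})
    (minimalH : minimal_machine H)
    (g_nonempty : exists X : {set state H}, X \in g H)
    (minimalP : minimal_state_cover H P)
    (charW : characterization_set H W) :
  complete H (ets g k P W H) (fault_domain g k P H).
Proof.
move=> S [le_card nonsink] agreeT; have [coverP _] := minimalP.
have tested_inj := @tested_inj I U H S W minimalH charW.
(* The second alternative covers unreached sinks of [S]; such a pair steps only to itself. *)
pose R (p : state H) (s : state S) :=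
  (exists2 x, access H P g k x
     & p = deltaw (init H) x /\ s = deltaw (init S) x) \/
  (forall i, [/\ delta p i = p, delta s i = s
               & val (lambda p i) = val (lambda s i)]).
apply: (@bisimulation_equiv _ _ _ _ R); last first.
  left; exists [::] => //; have [X gX] := g_nonempty.
  by exists X, [::], [::]; split=> //; exact: coverP.1.
move=> p s [[x accx [-> ->]] i|sink i]; last first.
  by have [-> -> ->] := sink i; split=> //; right.
have txi : tested H S W (x ++ [:: i]).
  by apply: access_tested1 agreeT _ _ accx _.
split; first exact (tested_lambda charW txi).
have eq_delta (M : mealy I U) :
    delta (deltaw (init M) x) i = deltaw (init M) (x ++ [:: i])
  by rewrite deltaw_cat.
rewrite !eq_delta; set t := deltaw (init S) _.
have [[y accy eq_t]|unreached] :=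
    pselect (exists2 y, access H P g k y & deltaw (init S) y = t).
  left; exists y => //; split=> //; apply: tested_inj => //.
  exact (access_tested agreeT accy).
have sink_t j : delta t j = t.
  have [//|nsink] := pselect (sinks S t).
  have [X gX [_ -> [_ [v Pv [u Ju <-]] eq_t]]] := nonsink t nsink.
  by case: unreached; exists (v ++ u) => //; exists X, v, u.
have unreached_t y : access H P g k y -> deltaw (init S) y <> t.
  by move=> accy eq_t; apply: unreached; exists y.
(* Only one-letter extensions of [x] are known to be tested; [y] reaches the same state of [S] and
   allows the two letters [i] and [j]. *)
have [y accy eq_s] :=
  access_shorter minimalH charW agreeT coverP le_card accx unreached_t.
right=> j.
have tyi : tested H S W (y ++ [:: i]).
  by apply: access_tested2 agreeT _ _ accy _.
have tyij : tested H S W ((y ++ [:: i]) ++ [:: j]).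
  by rewrite -catA; apply: access_tested2 agreeT _ _ accy _.
have eq_St : deltaw (init S) (y ++ [:: i]) = t.
  by rewrite deltaw_cat eq_s -deltaw_cat.
have -> : deltaw (init H) (x ++ [:: i]) = deltaw (init H) (y ++ [:: i]).
  exact: tested_inj.
split=> //; last by rewrite -eq_St; exact (tested_lambda charW tyij).
(* In [S] both [y ++ [:: i]] and its extension by [j] end in the sink [t], so in [H] they end in one
   state, where [j] is a loop. *)
have -> : delta (deltaw (init H) (y ++ [:: i])) j =
    deltaw (init H) ((y ++ [:: i]) ++ [:: j]) by rewrite [RHS]deltaw_cat.
by apply: tested_inj => //; rewrite deltaw_cat eq_St; exact: sink_t.
Qed.
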